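(* Let $A\in\mathbb{Z}^{m\times d}$ with $\ker_{\mathbb{Z}}(A)\cap\mathbb{N}^d=\{0\}$, let $\mathcal{M}\subset\ker_{\mathbb{Z}}(A)$ be a Markov basis for $A$, and let $(b_i)_{i\in\mathbb{N}}$ be a dominated sequence in $\mathbb{N}A$. Then the sequence of fiber graphs $(\mathcal{F}_{A,b_i}(\mathcal{M}))_{i\in\mathbb{N}}$ is not an expander. If additionally $(b_i)_{i\in\mathbb{N}}$ has a meaningful parametrization, then $(\mathcal{F}_{A,b_i}(\mathcal{M}))_{i\in\mathbb{N}}$ is not rapidly mixing.
   Context: $\mathbb{N}=\{0,1,2,\dots\}$. $\mathbb{N}A\subseteq\mathbb{Z}^m$ is the affine semigroup generated by the columns of $A$. For $b\in\mathbb{Z}^m$, the fiber is $\mathcal{F}_{A,b}=\{u\in\mathbb{N}^d: Au=b\}$ (finite by the kernel assumption) and its $\mathbb{Q}$-relaxation is the polytope $P_{A,b}=\{x\in\mathbb{Q}_{\ge0}^d: Ax=b\}$. For finite $\mathcal{F},\mathcal{M}\subset\mathbb{Z}^d$, the fiber graph $\mathcal{F}(\mathcal{M})$ is the graph on vertex set $\mathcal{F}$ in which two nodes $u,v$ are adjacent if $u-v\in\pm\mathcal{M}$, and where every node $w\in\mathcal{F}$ gets a loop for every $m\in\pm\mathcal{M}$ with $w+m\notin\mathcal{F}$ (multiple loops allowed); it is $|\pm\mathcal{M}|$-regular. A finite set $\mathcal{M}\subset\ker_{\mathbb{Z}}(A)$ is a Markov basis for $A$ if $\mathcal{F}_{A,b}(\mathcal{M})$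 is connected for every $b\in\mathbb{N}A$. For a graph $G$ on nodes $v_1,\dots,v_n$, let $A^G_{ij}$ be the number of edges with endpoints $v_i,v_j$ and $\deg_G(v_i)$ the number of edges incident to $v_i$; the simple walk has transition matrix $S^G_{ij}=A^G_{ij}/\deg_G(v_i)$. The second largest eigenvalue modulus (SLEM) of $S^G$ is the largest modulus of an eigenvalue after removing the eigenvalue $1$ once. For a sequence of graphs $G_i=(V_i,E_i)$ with SLEM $\lambda_i$ of $S^{G_i}$: the sequence is rapidly mixing if there is a polynomial $p\in\mathbb{Q}_{\ge0}[t]$ with $\lambda_i\le 1-\frac{1}{p(\log|V_i|)}$ for all $i$; it is an expander if there is $\epsilon>0$ with $\lambda_i\le1-\epsilon$ for all $i$. A sequence $(b_i)_{i\in\mathbb{N}}$ in $\mathbb{N}A$ is dominated if there exists $b\in\mathbb{N}A$ with $\dim(P_{A,b})>0$ such that $b_i-i\cdot b\in\mathbb{N}A$ for all $i\in\mathbb{N}$, and there exist $u\in\mathcal{F}_{A,b}$ and $w_i\in\mathcal{F}_{A,b_i-i\cdot b}$ with $\mathrm{supp}(w_i)\subseteq\mathrm{supp}(u)$ for all $i\in\mathbb{N}$. A sequence $(b_i)_{i\in\mathbb{N}}$ in $\mathbb{N}A$ has a meaningful parametrization if there is a polynomial $q\in\mathbb{Q}[t]$ with $|\mathcal{F}_{A,b_i}|\le q(i)$ for all $i\in\mathbb{N}$. *)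

(* Defs.v *)
From HB Require Import structures.
From mathcomp Require Import all_boot all_order all_algebra.
From mathcomp Require Import finmap complex.
From mathcomp Require Import boolp classical_sets cardinality reals exp.

Set Implicit Arguments.
Unset Strict Implicit.
Unset Printing Implicit Defensive.

Import Order.TTheory GRing.Theory Num.Theory.

Local Open Scope classical_set_scope.
Local Open Scope ring_scope.

(* Finite undirected multigraphs, given by the number of edges with endpoints
   v and w.  [nedges v v] is the number of loops at v; a loop is one edge and
   counts once in the degree. *)
Record multigraph := Multigraph {
  node :> finType;
  nedges : node -> node -> nat;
  nedgesC : forall v w, nedges v w = nedges w v
}.

Definition deg (G : multigraph) (v : G) : nat := (\sum_w nedges v w)%N.

Definition connected_graph (G : multigraph) : Prop :=
  forall v w : G, connect [rel x y | (0 < nedges x y)%N] v w.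

Section Mixing.
Context {R : realType}.

Definition simple_walk (G : multigraph) : 'M[R]_#|G| :=
  \matrix_(i, j) ((nedges (enum_val i) (enum_val j))%:R
                  / (deg (enum_val i))%:R).

(* The complex eigenvalues, listed with algebraic multiplicity. *)
Definition eigenvalues n (S : 'M[R]_n) : seq R[i] :=
  sval (closed_field_poly_normal (char_poly (map_mx (real_complex R) S))).

(* [rem] deletes one occurrence only.  The value is 0 if no eigenvalue is left,
   i.e. for a graph with a single node. *)
Definition slem n (S : 'M[R]_n) : R :=
  \big[Num.max/0]_(z <- rem 1 (eigenvalues S)) complex.Re `|z|.

Definition expander (G : nat -> multigraph) : Prop :=
  exists2 eps : R, 0 < eps &
    forall i, slem (simple_walk (G i)) <= 1 - eps.

(* Since 1 / 0 = 0 here, that 1 / p(log |V_i|) is meaningful has to be said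
   explicitly; otherwise p = 0 would qualify for every sequence. *)
Definition rapidly_mixing (G : nat -> multigraph) : Prop :=
  exists2 p : {poly rat}, p \is a polyOver Num.nneg &
    forall i, let t := (map_poly ratr p).[ln (#|G i|%:R : R)] in
      0 < t /\ slem (simple_walk (G i)) <= 1 - 1 / t.

End Mixing.

Arguments expander R G : clear implicits.
Arguments rapidly_mixing R G : clear implicits.

Section FiberGraph.
Variable d : nat.
Implicit Types F M : {fset 'cV[int]_d}.

Definition pm M : {fset 'cV[int]_d} := (M `|` [fset - x | x in M])%fset.

Lemma pmN M x : (- x \in pm M) = (x \in pm M).
Proof.
have h y : y \in pm M -> - y \in pm M.
  rewrite !in_fsetU => /orP[yM|/imfsetP[z /= zM ->]].
    by apply/orP; right; apply/imfsetP; exists y.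
  by rewrite opprK zM.
by apply/idP/idP => [/h|/h//]; rewrite opprK.
Qed.

(* The first summand is the edge between u and v (a loop at u if u = v and
   0 is in M); the second one is the number of rejected moves at u. *)
Definition fiber_nedges F M (u v : F) : nat :=
  (val u - val v \in pm M)
  + (u == v) * #|` [fset x in pm M | (val u + x)%R \notin F]%fset|.

Lemma fiber_nedgesC F M (u v : F) : fiber_nedges M u v = fiber_nedges M v u.
Proof.
rewrite /fiber_nedges -(pmN M (val u - val v)) opprB eq_sym.
by case: eqP => [->|].
Qed.

Definition fiber_graph F M : multigraph := Multigraph (@fiber_nedgesC F M).

End FiberGraph.

Definition supp d (u : 'cV[int]_d) : {set 'I_d} := finset (fun j => u j 0 != 0).

(* N^d as a subset of Z^d. *)
Definition orthant d : set 'cV[int]_d := [set u | forall j, 0 <= u j 0].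

Section Fibers.
Variables (m d : nat) (A : 'M[int]_(m, d)).

Definition kerZ : set 'cV[int]_d := [set u | A *m u = 0].

Definition semigroup : set 'cV[int]_m :=
  [set b | exists c : 'I_d -> nat, b = \sum_j col j A *+ c j].

Definition fiber (b : 'cV[int]_m) : set 'cV[int]_d :=
  [set u | orthant u /\ A *m u = b].

(* [fset_set] is only meaningful on finite sets; fibers are finite as soon as
   kerZ `&` orthant = [set 0]. *)
Definition fiber_fset (b : 'cV[int]_m) : {fset 'cV[int]_d} :=
  fset_set (fiber b).

Definition markov_basis (M : {fset 'cV[int]_d}) : Prop :=
  (forall x, x \in M -> kerZ x) /\
  forall b, semigroup b -> connected_graph (fiber_graph (fiber_fset b) M).

Definition polytope (b : 'cV[int]_m) : set 'cV[rat]_d :=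
  [set x : 'cV[rat]_d | (forall j, 0 <= x j 0) /\ map_mx intr A *m x = map_mx intr b].

End Fibers.

Definition affinely_independent d k (x : 'I_k.+1 -> 'cV[rat]_d) : bool :=
  row_free (\matrix_(i < k) (x (lift ord0 i) - x ord0)^T).

(* The dimension of (the affine hull of) P: one less than the largest number of
   affinely independent points of P.  The empty set gets 0 instead of -1. *)
Definition affine_dim d (P : set 'cV[rat]_d) : nat :=
  (\max_(k < d.+1 | `[< exists x : 'I_k.+1 -> 'cV[rat]_d,
                          (forall i, P (x i)) /\ affinely_independent x >]) k)%N.

Section Sequences.
Variables (m d : nat) (A : 'M[int]_(m, d)) (b : nat -> 'cV[int]_m).

Definition dominated : Prop :=
  exists b0 : 'cV[int]_m,
    [/\ semigroup A b0,
        (0 < affine_dim (polytope A b0))%N,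
        forall i, semigroup A (b i - b0 *+ i)
      & exists (u : 'cV[int]_d) (w : nat -> 'cV[int]_d),
          fiber A b0 u /\
          forall i, fiber A (b i - b0 *+ i) (w i) /\ supp (w i) \subset supp u].

Definition meaningful_parametrization : Prop :=
  exists q : {poly rat}, forall i, #|` fiber_fset A (b i)|%:R <= q.[i%:R].

End Sequences.

(* Main.v *)
(* All moves commute, so a k-step walk from a fixed node reaches at most
   (k + 1)^D nodes, where D is the degree of the graph, that is, the number of
   moves and their negatives.  On the other hand a spectral gap 1/t forces
   every entry of the k-th power of the walk matrix on n nodes to lie within
   (1 - 1/t)^k <= exp(- k/t) of 1/n, so an unreachable node can only exist
   for k <= t ln n.  Together, n <= (t ln n + 2)^D; when t is a fixed polynomial
   in ln n (a constant, for an expander) this bounds n.  But the fibers of a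
   dominated sequence are unbounded: if z <> z' are nonnegative integer points
   with A z = A z' = K b, then the fiber of b_(nK) contains the n + 1 points
   w_(nK) + a z + (n - a) z'. *)
Require Import Defs.
From mathcomp Require Import all_boot all_order all_algebra.
From mathcomp Require Import finmap complex.
From mathcomp Require Import boolp classical_sets functions cardinality reals sequences exp.
From mathcomp Require Import zify ring lra.

Set Implicit Arguments.
Unset Strict Implicit.
Unset Printing Implicit Defensive.

Import Order.TTheory GRing.Theory Num.Theory.

Local Open Scope classical_set_scope.
Local Open Scope ring_scope.

(** * Spectral estimate for powers of a matrix fixing the all-ones vector *)

Lemma char_poly_conj (F : fieldType) n (P B : 'M[F]_n) :
  P \in unitmx -> char_poly (invmx P *m B *m P) = char_poly B.
Proof.
move=> uP; rewrite /char_poly /char_poly_mx !map_mxM.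
set Q := map_mx polyC (invmx P); set P' := map_mx polyC P.
have QP : Q *m P' = 1%:M by rewrite -map_mxM mulVmx // map_mx1.
rewrite {1}(_ : 'X%:M = Q *m 'X%:M *m P'); last first.
  by rewrite scalar_mxC -mulmxA QP mulmx1.
by rewrite -mulmxBl -mulmxBr !det_mulmx mulrAC -det_mulmx QP det1 mul1r.
Qed.

Lemma exp_conj_diag (F : fieldType) n (P : 'M[F]_n) (D : 'rV[F]_n) k :
  P \in unitmx ->
  (invmx P *m diag_mx D *m P) ^+ k = invmx P *m diag_mx (map_mx (fun x => x ^+ k) D) *m P.
Proof.
move=> uP; elim: k => [|k IH].
  rewrite expr0 (_ : map_mx _ _ = const_mx 1); last by apply/rowP=> j; rewrite !mxE.
  by rewrite diag_const_mx mulmx1 mulVmx.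
rewrite exprS IH [LHS]mulmxA -!mulmxA mulKVmx //; congr (_ *m _).
rewrite !mulmxA; congr (_ *m _); rewrite mulmx_diag.
by congr diag_mx; apply/rowP => j; rewrite !mxE exprS.
Qed.

Lemma unitarymx_entries (C : numClosedFieldType) n (P : 'M[C]_n) i j :
  P \is unitarymx ->
  (\sum_l P i l * (P j l)^* = (i == j)%:R) *
  (\sum_l (P l i)^* * P l j = (i == j)%:R).
Proof.
move=> uP; split.
  have /unitarymxP/matrixP/(_ i j) := uP; rewrite !mxE => <-.
  by apply: eq_bigr => l _; rewrite !mxE.
have := mulVmx (unitarymx_unit uP); rewrite invmx_unitary //.
move=> /matrixP/(_ i j); rewrite !mxE => <-.
by apply: eq_bigr => l _; rewrite !mxE.
Qed.

(* The rows of the diagonalizing unitary [P] are orthonormal eigenvectors; the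
   one for the simple eigenvalue 1 contributes exactly 1/n to every entry of
   [A ^+ k], the others at most [r ^+ k] together. *)
Lemma normalmx_power_uniform (C : numClosedFieldType) n (A : 'M[C]_n)
    (s : seq C) (r : C) :
  A \is normalmx -> (const_mx 1 : 'rV_n) *m A = const_mx 1 ->
  char_poly A = \prod_(z <- s) ('X - z%:P) ->
  {in rem 1 s, forall z, `|z| <= r} -> 0 <= r -> r < 1 ->
  forall k i j, `|(A ^+ k) i j - n%:R^-1| <= r ^+ k.
Proof.
move=> nA cA chA le_r r0 r1 k i j.
have n0 : n%:R != 0 :> C by rewrite pnatr_eq0; case: n i {A nA cA chA j} => [[]|].
have /orthomx_spectralP := nA.
set P := spectralmx A; set D := spectral_diag A => AE.
have unP : P \is unitarymx := spectral_unitarymx A.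
have uP := unitarymx_unit unP.
pose ds := [seq D 0 l | l <- enum 'I_n].
have /prod_XsubC_eq s_ds : \prod_(z <- s) ('X - z%:P) = \prod_(z <- ds) ('X - z%:P).
  rewrite -chA AE char_poly_conj // char_poly_trig ?diag_mx_is_trig //.
  rewrite big_map big_enum /=; apply: eq_bigr => l _.
  by rewrite mxE eqxx mulr1n.
pose c : 'rV[C]_n := const_mx 1.
(* [a] holds the coordinates of the all-ones vector in the eigenbasis. Since [A] fixes that vector,
   [a] is supported on the indices with eigenvalue 1. *)
pose a := c *m invmx P.
have cE : c = a *m P by rewrite /a mulmxKV.
have aD l : a 0 l * D 0 l = a 0 l.
  have : a *m diag_mx D = a.
    by rewrite /a -[in RHS](cA : c *m A = c) AE !mulmxA mulmxK.
  by move=> /rowP/(_ l); rewrite mul_mx_diag !mxE.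
have [l0 al0] : exists l, a 0 l != 0.
  apply/existsP; apply: contraT; rewrite negb_exists => /forallP al.
  have : c 0 i = 0.
    by rewrite cE mxE big1 // => l _; have /negPn/eqP-> := al l; rewrite mul0r.
  by rewrite mxE => /eqP; rewrite oner_eq0.
have Dl0 : D 0 l0 = 1 by apply: (mulfI al0); rewrite aD mulr1.
(* Deleting one 1 from [s] amounts to deleting the index [l0]: [s] is a permutation of the diagonal
   of [D], and [D 0 l0 = 1]. *)
have le_D l : l != l0 -> `|D 0 l| <= r.
  move=> ll0; apply: le_r.
  have /perm_mem -> : perm_eq (rem 1 s) [seq D 0 l | l <- rem l0 (enum 'I_n)].
    rewrite -(perm_cons 1).
    have s1 : 1 \in s.
      by rewrite (perm_mem s_ds) -Dl0 map_f // mem_enum.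
    rewrite -(permPl (perm_to_rem s1)) (permPl s_ds) -{1}Dl0 -map_cons.
    by apply: perm_map; rewrite perm_to_rem // mem_enum.
  by apply: map_f; rewrite rem_filter ?enum_uniq // mem_filter /= ll0 mem_enum.
(* As [r < 1], only [l0] carries the eigenvalue 1, so the all-ones vector is a multiple of row [l0]
   of [P]. *)
have a0 l : l != l0 -> a 0 l = 0.
  move=> /le_D lD; apply/eqP; apply: contraT => al.
  have Dl : D 0 l = 1 by apply: (mulfI al); rewrite aD mulr1.
  by move: (le_lt_trans lD r1); rewrite Dl normr1 ltxx.
have cl l : a 0 l0 * P l0 l = 1.
  have /rowP/(_ l) := cE; rewrite [LHS]mxE [RHS]mxE (bigD1 l0) //= big1 ?addr0 // => l' /a0 ->.
  by rewrite mul0r.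
have Pij : (P l0 i)^* * P l0 j = n%:R^-1.
  have Pl l : P l0 l = (a 0 l0)^-1 by apply: (mulfI al0); rewrite cl mulfV.
  have := (unitarymx_entries l0 l0 unP).1.
  rewrite eqxx !Pl; under eq_bigr do rewrite !Pl.
  rewrite sumr_const card_ord -[LHS]mulr_natl => e.
  by apply: (mulfI n0); rewrite mulfV // [_^* * _]mulrC.
have AkE : (A ^+ k) i j = \sum_l (P l i)^* * D 0 l ^+ k * P l j.
  rewrite AE exp_conj_diag // invmx_unitary // mxE; apply: eq_bigr => l _.
  by rewrite mul_mx_diag !mxE.
rewrite AkE (bigD1 l0) //= Dl0 expr1n mulr1 Pij addrC addrK.
(* This splits the products of entries of columns [i] and [j] into squares, whose sums over [l] are
   column norms of a unitary matrix, hence 1. *)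
have half (x y : C) : `|x| * `|y| <= 2^-1 * (`|x| ^+ 2 + `|y| ^+ 2).
  rewrite -(ler_pM2l (ltr0Sn C 1)) mulVKf ?pnatr_eq0 //.
  rewrite -subr_ge0 [X in 0 <= X](_ : _ = (`|x| - `|y|) ^+ 2); last by ring.
  by rewrite real_exprn_even_ge0 // rpredB // normr_real.
have norm_col m : \sum_l `|P l m| ^+ 2 = 1.
  have e : \sum_l (P l m)^* * P l m = 1 by rewrite (unitarymx_entries m m unP).2 eqxx.
  by rewrite -[RHS]e; apply: eq_bigr => l _; rewrite normCKC.
apply: (le_trans (ler_norm_sum _ _ _)).
apply: (@le_trans _ _ (\sum_l r ^+ k * (2^-1 * (`|P l i| ^+ 2 + `|P l j| ^+ 2)))).
  rewrite [leRHS](bigD1 l0) //= -[leLHS]add0r lerD //.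
    by rewrite mulr_ge0 ?exprn_ge0 // mulr_ge0 ?addr_ge0 ?exprn_ge0 // invr_ge0 ler0n.
  apply: ler_sum => l ll0; rewrite mulrAC !normrM mulrC normrX norm_conjC.
  rewrite ler_pM ?mulr_ge0 ?exprn_ge0 //.
  by rewrite lerXn2r ?nnegrE ?le_D.
rewrite -mulr_sumr -mulr_sumr big_split /= !norm_col -[1 + 1]/2.
by rewrite mulVf ?pnatr_eq0 // mulr1.
Qed.

Lemma slem_ge0 (R : realType) n (S : 'M[R]_n) : 0 <= slem S.
Proof.
by rewrite /slem; elim: rem => [|z s IH]; rewrite ?big_nil // big_cons le_max IH orbT.
Qed.

Lemma le_slem (R : realType) n (S : 'M[R]_n) (z : R[i]) :
  z \in rem 1 (eigenvalues S) -> `|z| <= (slem S)%:C%C.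
Proof.
move=> zS; rewrite -(RRe_real (normr_real z)) lecR /slem.
elim: rem zS => // y s IH; rewrite inE big_cons le_max => /predU1P[->|/IH->].
  by rewrite lexx.
by rewrite orbT.
Qed.

(** A real symmetric matrix is normal over [R[i]], and the embedding of [R] preserves powers and
    absolute values, so the complex estimate descends. *)
Lemma slem_power_uniform (R : realType) n (S : 'M[R]_n) :
  S^T = S -> (const_mx 1 : 'rV_n) *m S = const_mx 1 -> slem S < 1 ->
  forall k i j, `|(S ^+ k) i j - n%:R^-1| <= slem S ^+ k.
Proof.
move=> symS cS lt1 k i j.
pose f := real_complex R; pose A := map_mx f S.
have powE : (A ^+ k) i j = f ((S ^+ k) i j).
  have -> : A ^+ k = map_mx f (S ^+ k).
    elim: (k) => [|l IH]; first by rewrite !expr0 map_mx1.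
    by rewrite !exprS IH [in RHS]map_mxM.
  by rewrite mxE.
have chA : char_poly A = \prod_(z <- eigenvalues S) ('X - z%:P).
  rewrite /eigenvalues; case: closed_field_poly_normal => s /= {1}->.
  by rewrite (monicP (char_poly_monic _)) scale1r.
have nA : A \is normalmx.
  apply: symmetric_normalmx.
    by apply/is_hermitianmxP; rewrite expr0 scale1r map_mx_id // map_trmx symS.
  by apply/mxOverP => x y; rewrite mxE; apply/complex_realP; exists (S x y).
have cA : (const_mx 1 : 'rV_n) *m A = const_mx 1.
  rewrite -[const_mx 1 in LHS](map_const_mx f) -map_mxM cS.
  by apply/rowP => x; rewrite !mxE.
have := normalmx_power_uniform nA cA chA (@le_slem _ _ S) _ _ k i j.
rewrite ler0c slem_ge0 powE (ltcR (slem S) 1) lt1 => /(_ isT isT).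
suff -> : `|f ((S ^+ k) i j) - n%:R^-1| = f `|(S ^+ k) i j - n%:R^-1|.
  by rewrite -[(slem S)%:C%C]/(f (slem S)) -(rmorphXn (real_complex R)) lecR.
have -> : n%:R^-1 = f n%:R^-1 by rewrite /f fmorphV rmorph_nat.
by rewrite -(rmorphB (real_complex R)) normc_def /= expr0n addr0 sqrtr_sqr.
Qed.

(** * The simple walk on a fiber graph *)

(** Each signed move is counted once at [v]: as an edge if it stays in [F], as a rejection loop if
    it leaves. *)
Lemma deg_fiber_graph d (F M : {fset 'cV[int]_d}) (v : fiber_graph F M) :
  deg v = #|` pm M|.
Proof.
pose u : F := v.
rewrite /deg /= /fiber_nedges big_split /=.
have := pmN M; move: (pm M) => N NN.
have -> : (\sum_(w : F) (u == w) * #|` [fset x in N | (val u + x)%R \notin F]%fset| =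
    #|` [fset x in N | (val u + x)%R \notin F]%fset|)%N.
  rewrite (bigD1 u) //= eqxx mul1n big1 ?addn0 // => w.
  by rewrite eq_sym => /negbTE ->.
have -> : (\sum_(w : F) ((val u - val w)%R \in N) =
    #|` [fset x in N | (val u + x)%R \in F]%fset|)%N.
  rewrite -big_mkcond /= sum1_card.
  pose P := [set w : F | (val u - val w)%R \in N]%SET.
  rewrite -[LHS](_ : #|P| = _); last first.
    by apply: eq_card => w; rewrite inE.
  rewrite cardE -(size_map (fun w : F => (val w - val u)%R)).
  have uq : uniq [seq (val w - val u)%R | w : F <- enum P].
    rewrite map_inj_uniq ?enum_uniq // => w w' /addIr; exact: val_inj.
  rewrite -(undup_id uq) -card_fseq; congr (#|` _ |).
  apply/fsetP => x; rewrite !inE; apply/mapP/andP => [[w]|[xM xF]].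
    rewrite mem_enum inE => uw ->; rewrite -NN opprB uw; split=> //.
    by rewrite addrC subrK fsvalP.
  exists [` xF]%fset; last by rewrite /= addrC addKr.
  by rewrite mem_enum inE /= opprD addNKr NN.
rewrite -[RHS](cardfsID [fset x in N | (val u + x)%R \in F]%fset).
by congr addn; congr (#|` _ |); apply/fsetP => x;
  rewrite !inE; case: (x \in N); rewrite ?andbT ?andbF.
Qed.

Lemma regular_walk_sym (R : realType) (G : multigraph) D :
  (forall v : G, deg v = D) -> (simple_walk G)^T = simple_walk G :> 'M[R]_#|G|.
Proof. by move=> dG; apply/matrixP => i j; rewrite !mxE !dG nedgesC. Qed.

(** Symmetry of the edge counts turns column sums into row sums, which are [D / D]; [0 < D] makes
    this quotient 1. *)
Lemma regular_walk_const (R : realType) (G : multigraph) D :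
  (0 < D)%N -> (forall v : G, deg v = D) ->
  (const_mx 1 : 'rV_#|G|) *m simple_walk G = const_mx 1 :> 'rV[R]_#|G|.
Proof.
move=> D0 dG; apply/rowP => j; rewrite !mxE.
under eq_bigr do rewrite !mxE mul1r dG nedgesC.
rewrite -mulr_suml -natr_sum -(dG (enum_val j)) /deg.
rewrite [X in _ / X%:R](reindex (fun i : 'I_#|G| => enum_val i)) /=; last first.
  exact/onW_bij/enum_val_bij.
rewrite mulfV // pnatr_eq0 -lt0n.
move: D0; rewrite -(dG (enum_val j)) /deg.
by rewrite (reindex (fun i : 'I_#|G| => enum_val i)) //; apply/onW_bij/enum_val_bij.
Qed.

(* The moves commute, so only the multiplicity of each move on a walk matters. *)
Lemma walk_support (R : realType) d (F M : {fset 'cV[int]_d}) k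
    (i j : 'I_#|fiber_graph F M|) :
  (simple_walk (fiber_graph F M) ^+ k) i j != 0 :> R ->
  exists c : {ffun pm M -> 'I_k.+1},
    val (enum_val j : F) = val (enum_val i : F) + \sum_x val x *+ c x.
Proof.
elim: k j => [|k IH] j.
  rewrite expr0 mxE; have [->|_] := eqVneq i j; last by rewrite eqxx.
  move=> _;  exists [ffun=> ord0].
  by rewrite big1 ?addr0 // => x _; rewrite ffunE.
rewrite exprSr mxE => nz.
have [l /=] : exists l, (simple_walk (fiber_graph F M) ^+ k) i l *
    (simple_walk (fiber_graph F M)) l j != 0 :> R.
  apply/existsP; apply: contraNT nz; rewrite negb_exists => /forallP z.
  by rewrite big1 // => l _; apply/eqP; have /negPn := z l.
rewrite mulf_eq0 negb_or => /andP[/IH[c lE]].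
(* A loop adds no displacement, so the old multiplicities serve, viewed in the larger range.
   Otherwise the last step is a move [x0], whose multiplicity grows by one. *)
have [elj|lj] := eqVneq l j.
  move=> _; exists [ffun x => widen_ord (leqnSn _) (c x)].
  by rewrite -elj lE; congr (_ + _); apply: eq_bigr => x _; rewrite ffunE.
rewrite mxE /= mulf_eq0 negb_or pnatr_eq0 => /andP[].
rewrite /fiber_nedges (inj_eq enum_val_inj) (negbTE lj) mul0n addn0.
rewrite eqb0 negbK -pmN opprB => mM _.
set m := (X in X \in pm M) in mM; pose x0 : pm M := [` mM]%fset.
exists [ffun x => inord (c x + (x == x0))%N].
have -> : val (enum_val j : F) = val (enum_val l : F) + m by rewrite addrC subrK.
rewrite lE -addrA; congr (_ + _).
transitivity (\sum_x (val x *+ c x + val x *+ (x == x0))); last first.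
  apply: eq_bigr => x _; rewrite ffunE inordK ?mulrnDr //.
  by move: (ltn_ord (c x)); case: (x == x0) => /=; lia.
rewrite big_split /=; congr (_ + _).
by rewrite (bigD1 x0) //= eqxx mulr1n big1 ?addr0 // => x /negbTE ->.
Qed.

(** If row [i] had no zero entry, every node would be determined by a vector of move multiplicities,
    and there are too few of these. *)
Lemma power_walk_zero (R : realType) d (F M : {fset 'cV[int]_d}) k :
  (k.+1 ^ #|` pm M| < #|fiber_graph F M|)%N ->
  exists i j, (simple_walk (fiber_graph F M) ^+ k) i j = 0 :> R.
Proof.
move=> lt_n; have n0 : (0 < #|fiber_graph F M|)%N by exact: leq_ltn_trans lt_n.
pose i := Ordinal n0; exists i; apply: contrapT => nz.
have reach (j : 'I_#|fiber_graph F M|) : exists c : {ffun pm M -> 'I_k.+1},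
    val (enum_val j : F) = val (enum_val i : F) + \sum_x val x *+ c x.
  by apply: (@walk_support R); apply/eqP => z; apply: nz; exists j.
pose f j := sval (cid (reach j)).
have injf : injective f.
  move=> j j' e; apply: enum_val_inj; apply: val_inj.
  rewrite (svalP (cid (reach j))) (svalP (cid (reach j'))) -/(f j) -/(f j').
  by rewrite e.
have := leq_card f injf.
by rewrite card_ord card_ffun card_ord -(cardfE (pm M)) leqNgt lt_n.
Qed.

(** At a zero entry the distance to the uniform value is exactly [1/n]. *)
Lemma slem_lower_bound (R : realType) d (F M : {fset 'cV[int]_d}) k :
  (0 < #|` pm M|)%N -> slem (simple_walk (fiber_graph F M)) < 1 :> R ->
  (k.+1 ^ #|` pm M| < #|fiber_graph F M|)%N ->
  #|fiber_graph F M|%:R^-1 <= slem (simple_walk (fiber_graph F M)) ^+ k :> R.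
Proof.
move=> D0 lt1 /(@power_walk_zero R)[i [j z]].
have regG := @deg_fiber_graph d F M.
have := slem_power_uniform (regular_walk_sym R regG) (regular_walk_const R D0 regG) lt1 k i j.
by rewrite z add0r normrN ger0_norm // invr_ge0 ler0n.
Qed.

(** * From a spectral gap to a bound on the number of nodes *)

Lemma mixing_size_bound (R : realType) (n D : nat) (t s : R) :
  (0 < n)%N -> 0 < t -> 0 <= s -> s <= 1 - 1 / t ->
  (forall k, (k.+1 ^ D < n)%N -> n%:R^-1 <= s ^+ k) ->
  n%:R <= (t * ln n%:R + 2) ^+ D.
Proof.
move=> n0 t0 s0 st nk; rewrite leNgt; apply/negP => lt_n.
have n0' : 0 < n%:R :> R by rewrite ltr0n.
have tl0 : 0 <= t * ln n%:R by rewrite mulr_ge0 ?ln_ge0 ?ler1n // ltW.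
(* The least natural number above [t * ln n], so that [exp(- k/t) < 1/n]; moreover
   [k + 1 <= t * ln n + 2], whence [(k + 1) ^ D < n]. *)
pose k := (Num.truncn (t * ln n%:R : R)).+1.
have k_le : k%:R <= t * ln n%:R + 1.
  by rewrite -natr1 lerD2r truncn_le.
have lt_k : t * ln n%:R < k%:R by exact: truncnS_gt.
have : n%:R^-1 <= s ^+ k.
  apply: nk; rewrite -(ltr_nat R); apply: le_lt_trans lt_n.
  rewrite natrX lerXn2r ?nnegrE ?ler0n //; first by rewrite addr_ge0.
  by rewrite -natr1; lra.
have le_exp : s ^+ k <= expR (- (k%:R / t)).
  rewrite -mulrN expRM_natl lerXn2r ?nnegrE ?expR_ge0 //.
  by apply: le_trans st _; rewrite div1r; exact: expR_ge1Dx.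
move=> /le_trans/(_ le_exp).
rewrite -[n%:R in leLHS]lnK ?posrE // -expRN ler_expR lerN2 ler_pdivrMr // mulrC.
by rewrite leNgt lt_k.
Qed.

Lemma horner_le_expn (R : realDomainType) (p : {poly R}) (y : R) :
  1 <= y -> p.[y] <= (\sum_(i < size p) `|p`_i|) * y ^+ size p.
Proof.
move=> y1; rewrite horner_coef mulr_suml; apply: ler_sum => i _.
apply: (le_trans (ler_norm _)); rewrite normrM ler_wpM2l // ger0_norm.
  by rewrite ler_weXn2l // ltnW.
by rewrite exprn_ge0 // (le_trans ler01).
Qed.

Lemma nat_le_poly_ln_bounded (R : realType) (p : {poly R}) :
  exists N : nat, forall n, (0 < n)%N -> n%:R <= p.[ln n%:R] -> (n <= N)%N.
Proof.
set e := size p; pose c : R := \sum_(i < e) `|p`_i|.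
(* Put [n = exp y]. For [y >= 1], comparing [y ^ (e+1) / (e+1)! <= exp y] with [p(y) <= c * y ^ e]
   gives [y <= c * (e+1)!]; the 1 covers [y <= 1]. *)
pose K : R := Num.max 1 (c * (e.+1)`!%:R).
exists (Num.truncn (expR K)).+1 => n n0.
have n0' : 0 < n%:R :> R by rewrite ltr0n.
move: (lnK n0'); set y := ln n%:R => ny le_n.
suff yK : y <= K.
  rewrite -(ler_nat R) (le_trans _ (ltW (truncnS_gt _))) //.
  by rewrite -ny ler_expR.
rewrite le_max; have [//|/ltW y1 /=] := leP y 1.
have y0 : 0 < y by exact: lt_le_trans y1.
have f0 : 0 < (e.+1)`!%:R :> R by rewrite ltr0n fact_gt0.
have := expR_ge1Dxn e (ltW y0); rewrite ny => /le_trans/(_ le_n).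
move=> /le_trans/(_ (horner_le_expn _ y1)); rewrite -/e -/c => h.
have : y ^+ e.+1 / (e.+1)`!%:R <= c * y ^+ e by apply: le_trans h; rewrite lerDr.
by rewrite ler_pdivrMr // exprS mulrAC ler_pM2r // exprn_gt0.
Qed.

(** The bound [(t * ln n + 2) ^ D] is itself a polynomial in [ln n] that depends on [M] and [p]
    only, so one [N] serves all [F]. *)
Lemma fiber_graph_size_bounded (R : realType) d (M : {fset 'cV[int]_d}) (p : {poly R}) :
  exists N : nat, forall F : {fset 'cV[int]_d},
    connected_graph (fiber_graph F M) ->
    let t := p.[ln #|fiber_graph F M|%:R] in
    0 < t -> slem (simple_walk (fiber_graph F M)) <= 1 - 1 / t ->
    (#|` F| <= N)%N.
Proof.
have [N bN] := nat_le_poly_ln_bounded ((p * 'X + 2%:P) ^+ #|` pm M|).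
exists (maxn 1 N) => F conF /= t0 le_s; rewrite cardfE leq_max.
have [//|n1 /=] := leqP #|{: F}| 1.
(* Without moves there are no edges, and a connected graph would have at most one node. *)
have D0 : (0 < #|` pm M|)%N.
  rewrite lt0n cardfs_eq0; apply/eqP => M0.
  have /card_gt1P[v [w [_ _]]] := n1; case/eqP.
  have /connectP[[|v' s] /=] := conF v w; first by [].
  rewrite /fiber_nedges M0 => /andP[+ _].
  rewrite inE /= [X in (_ * X)%N](_ : _ = 0%N) ?muln0 //.
  by apply/eqP; rewrite cardfs_eq0; apply/eqP/fsetP => x; rewrite !inE.
apply: bN; first exact: ltnW.
rewrite horner_exp hornerD hornerM hornerX hornerC.
apply: (mixing_size_bound (ltnW n1) t0 (slem_ge0 _) le_s) => k.
apply: slem_lower_bound => //; apply: le_lt_trans le_s _.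
by rewrite ltrBlDr ltrDl div1r invr_gt0.
Qed.

(** * Dickson's lemma and the finiteness of fibers *)

Lemma nondecreasing_subsequence (f : nat -> nat) :
  exists2 phi : nat -> nat, {homo phi : i j / (i < j)%N} &
    {homo f \o phi : i j / (i <= j)%N}.
Proof.
(* Beyond every [N] some index minimizes [f] over its whole tail, by descent on [f N]. The
   subsequence strings such indices together. *)
have ex_min N : exists n, (N <= n)%N /\ forall m, (n <= m)%N -> (f n <= f m)%N.
  have [k] := ubnP (f N); elim: k N => // k IH N fN.
  have [h|/existsNP[m /not_implyP[Nm /negP]]] :=
    pselect (forall m, (N <= m)%N -> (f N <= f m)%N); first by exists N.
  rewrite -ltnNge => mN; have [|n [mn h]] := IH m; first exact: leq_trans mN _.
  by exists n; split=> //; exact: leq_trans mn.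
have [g gP] := choice ex_min.
pose phi i := iter i (fun n => g n.+1) (g 0%N).
have phi_min i m : (phi i <= m)%N -> (f (phi i) <= f m)%N.
  by case: i => [|i]; apply: (gP _).2.
have incr : {homo phi : i j / (i < j)%N}.
  by apply: homo_ltn => [? ? ?|i]; [exact: ltn_trans | exact: (gP _).1].
exists phi => // i j; rewrite leq_eqVlt => /predU1P[->//|ij] /=.
by apply: phi_min; exact/ltnW/incr.
Qed.

(** Passing to a subsequence for one coordinate after another makes all of them nondecreasing; its
    first two terms then compare. *)
Lemma dickson (T : finType) (s : nat -> T -> nat) :
  exists i j, (i < j)%N /\ forall l, (s i l <= s j l)%N.
Proof.
suff [phi incr mono] : exists2 phi : nat -> nat, {homo phi : i j / (i < j)%N} &
    {in enum T, forall l, {homo (fun i => s (phi i) l) : i j / (i <= j)%N}}.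
  exists (phi 0%N), (phi 1%N); split; first exact: incr.
  by move=> l; apply: mono => //; rewrite mem_enum.
elim: (enum T) => [|l ls [phi incr mono]]; first by exists id.
have [psi incr' mono'] := nondecreasing_subsequence (fun i => s (phi i) l).
exists (phi \o psi); first by move=> i j /incr'/incr.
move=> l'; rewrite inE => /predU1P[->|l's i j ij]; first exact: mono'.
apply: mono => //; move: ij; rewrite leq_eqVlt => /predU1P[->//|/incr'].
exact: ltnW.
Qed.

(** An infinite fiber would contain two distinct points comparable in every coordinate; their
    difference would be a nonzero nonnegative kernel vector. *)
Lemma finite_fiber m d (A : 'M[int]_(m, d)) (b : 'cV[int]_m) :
  kerZ A `&` @orthant d = [set 0] -> finite_set (fiber A b).
Proof.
move=> kerA; apply: contrapT => /infiniteP/card_leP[g].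
pose f (i : nat) := set_val (g (exist _ i (mem_set (I : [set: nat] i)))).
have fP i : fiber A b (f i) by exact: set_valP.
have injf : injective f.
  by move=> i j /val_inj/(@inj _ _ _ g) => /(_ (mem_set I) (mem_set I)) [].
have [i [j [ij le_ij]]] := dickson (fun n (l : 'I_d) => `|(f n l 0)%R|%N).
have : (kerZ A `&` @orthant d) (f j - f i).
  split; first by rewrite /kerZ /= mulmxBr (fP j).2 (fP i).2 subrr.
  move=> l; rewrite !mxE subr_ge0.
  by rewrite -(gez0_abs ((fP i).1 l)) -(gez0_abs ((fP j).1 l)) lez_nat.
rewrite kerA => /eqP; rewrite subr_eq0 => /eqP fij.
have ji : j = i by exact: injf.
by rewrite ji ltnn in ij.
Qed.

(** * Unbounded fibers along a dominated sequence *)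

Lemma clear_denominators d (x : 'cV[rat]_d) :
  exists N (y : 'cV[int]_d), (0 < N)%N /\ map_mx intr y = N%:R *: x.
Proof.
(* The multiplier is the product of all denominators; in entry [j] the factor [denq (x j 0)]
   cancels. *)
pose y := \col_j ((\prod_(l | l != j) denq (x l 0)) * numq (x j 0)) : 'cV[int]_d.
have p0 : 0 < \prod_l denq (x l 0) by apply: prodr_gt0 => l _; exact: denq_gt0.
exists `|(\prod_l denq (x l 0))%R|%N, y; split; first by rewrite absz_gt0 gt_eqF.
apply/matrixP => j z; rewrite ord1 !mxE pmulrn gez0_abs ?ltW //.
rewrite [\prod_l _](bigD1 j) //= [denq _ * _]mulrC !intrM -mulrA; congr (_ * _).
by rewrite numqE mulrC.
Qed.

Lemma affine_dim_gt0 d (P : set 'cV[rat]_d) :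
  (0 < affine_dim P)%N -> exists x y, [/\ P x, P y & x != y].
Proof.
rewrite /affine_dim => /gtn_eqF/negbT.
have [/existsP[k /andP[/asboolP[x [Px free]] k0]] _|] :=
  boolP [exists k : 'I_d.+1, `[< exists x : 'I_k.+1 -> 'cV[rat]_d,
     (forall i, P (x i)) /\ affinely_independent x >] && (0 < k)%N]; last first.
  rewrite negb_exists => /forallP h; rewrite big1 // => k Pk.
  by have := h k; rewrite Pk /= -leqNgt leqn0 => /eqP.
exists (x (lift ord0 (Ordinal k0))), (x ord0); split=> //.
(* Equal points would give a zero row in a matrix that has a right inverse. *)
apply: contraTneq free => e; rewrite /affinely_independent.
set X := (\matrix_(i < k) _); apply/negP => freeX.
have := congr1 (fun M => M *m pinvmx X) (rowE (Ordinal k0) X).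
rewrite rowK e subrr trmx0 mul0mx -mulmxA mulmxVp // mulmx1.
by move=> /rowP/(_ (Ordinal k0)); rewrite !mxE !eqxx => /eqP; rewrite eq_sym oner_eq0.
Qed.

Lemma fiberD m d (A : 'M[int]_(m, d)) b b' u u' :
  fiber A b u -> fiber A b' u' -> fiber A (b + b') (u + u').
Proof.
move=> [u0 uE] [u0' uE']; split; last by rewrite mulmxDr uE uE'.
by move=> l; rewrite mxE addr_ge0 ?u0 ?u0'.
Qed.

Lemma fiberMn m d (A : 'M[int]_(m, d)) b u n :
  fiber A b u -> fiber A (b *+ n) (u *+ n).
Proof.
move=> uP; elim: n => [|n IH]; last by rewrite !mulrS; exact: fiberD.
by split; [move=> l; rewrite mxE | rewrite mulmx0].
Qed.

Lemma polytope_fiber m d (A : 'M[int]_(m, d)) b x N (y : 'cV[int]_d) :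
  polytope A b x -> map_mx intr y = N%:R *: x -> fiber A (b *+ N) y.
Proof.
move=> [x0 xE] yE; split.
  move=> l; rewrite -(ler_int rat).
  by have /colP/(_ l) := yE; rewrite !mxE => ->; rewrite mulr_ge0 ?ler0n.
have : map_mx intr (A *m y) = map_mx intr (b *+ N) :> 'cV[rat]_m.
  by rewrite map_mxM yE -scalemxAr xE scaler_nat raddfMn.
by move=> /colP e; apply/colP => i; have := e i; rewrite !mxE => /intr_inj.
Qed.

Lemma dominated_fibers_unbounded m d (A : 'M[int]_(m, d)) (b : nat -> 'cV[int]_m) :
  kerZ A `&` @orthant d = [set 0] -> dominated A b ->
  forall n, exists i, (n < #|` fiber_fset A (b i)|)%N.
Proof.
move=> kerA [b0 [_ /affine_dim_gt0[x [x' [Px Px' xx']]] _ [u [w [_ wP]]]]] n.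
have [N [y [N0 yE]]] := clear_denominators x.
have [N' [y' [N'0 yE']]] := clear_denominators x'.
(* Scaling crosswise puts both points over the same right-hand side [b0 *+ (N * N')]; they equal
   [N * N'] times [x] and [x'], hence differ. *)
pose z := y *+ N'; pose z' := y' *+ N.
have zP : fiber A (b0 *+ (N * N')) z.
  by rewrite mulrnA; exact/fiberMn/(polytope_fiber Px yE).
have zP' : fiber A (b0 *+ (N * N')) z'.
  by rewrite mulnC mulrnA; exact/fiberMn/(polytope_fiber Px' yE').
have /eqP zz' : z != z'.
  apply: contra_neq xx' => e.
  have := congr1 (map_mx (intr : int -> rat)) e.
  rewrite !raddfMn /= yE yE' -!scaler_nat !scalerA -!natrM mulnC.
  by apply: scalerI; rewrite pnatr_eq0 -lt0n muln_gt0 N0.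
clearbody z z'; have [l zl] : exists l, z l 0 != z' l 0.
  apply: contrapT => h; apply: zz'; apply/colP => l; apply/eqP.
  by apply: contrapT => /negP zl; apply: h; exists l.
pose i := (N * N' * n)%N; exists i.
pose p (a : 'I_n.+1) := w i + z *+ a + z' *+ (n - a).
have pP a : fiber A (b i) (p a).
  have -> : b i = b i - b0 *+ i + b0 *+ (N * N') *+ a + b0 *+ (N * N') *+ (n - a).
    by rewrite -addrA -mulrnDr (subnKC (leq_ord a)) -mulrnA subrK.
  apply: fiberD; last exact: fiberMn.
  by apply: fiberD; [exact: (wP i).1 | exact: fiberMn].
(* In coordinate [l], the points [p a] and [p a'] differ by [(a - a') * (z l 0 - z' l 0)], and the
   second factor is nonzero. *)
have injp : injective p.
  move=> a a' /colP/(_ l); rewrite /p !mxE !mulmxnE => e; apply: val_inj => /=.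
  move: zl e (ltn_ord a) (ltn_ord a'); rewrite -!(mulr_natr (z l 0)) -!(mulr_natr (z' l 0)).
  move: (z l 0) (z' l 0) (w i l 0) => s s' t.
  move: (val a) (val a') => {}a {}a' ss' e an an'.
  apply/eqP; rewrite -(eqr_nat int) -subr_eq0.
  have : (s - s') * (a%:R - a'%:R) = 0 by move: e; rewrite !natrB //; lia.
  by move=> /eqP; rewrite mulf_eq0 (subr_eq0 s) (negbTE ss').
rewrite -[X in (X <= _)%N](card_ord n.+1) -cardsT.
have -> : #|[set: 'I_n.+1]%SET| = #|` [fset p a | a in 'I_n.+1]%fset|.
  by rewrite card_imfset //= cardsT cardE.
apply: fsubset_leq_card; apply/fsubsetP => _ /imfsetP[a _ ->].
by rewrite in_fset_set ?mem_set //; exact: finite_fiber.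
Qed.

Theorem theorem1p1 (R : realType) (m d : nat) (A : 'M[int]_(m, d))
    (M : {fset 'cV[int]_d}) (b : nat -> 'cV[int]_m) :
  kerZ A `&` @orthant d = [set 0] ->
  markov_basis A M ->
  (forall i, semigroup A (b i)) ->
  dominated A b ->
  ~ expander R (fun i => fiber_graph (fiber_fset A (b i)) M) /\
  (meaningful_parametrization A b ->
   ~ rapidly_mixing R (fun i => fiber_graph (fiber_fset A (b i)) M)).
Proof.
move=> kerA [_ conM] bA domA.
(* A gap [1/t] with [t] a real polynomial in [ln n] covers both claims: for an expander, [t] is the
   constant [1/eps]. *)
have unbounded (p : {poly R}) : ~ forall i,
    let G := fiber_graph (fiber_fset A (b i)) M in
    let t := p.[ln #|G|%:R] in 0 < t /\ slem (simple_walk G) <= 1 - 1 / t.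
  move=> h; have [N bN] := fiber_graph_size_bounded M p.
  have [i iP] := dominated_fibers_unbounded kerA domA N; move: iP.
  by rewrite ltnNge bN //; [exact/conM/bA | exact: (h i).1 | exact: (h i).2].
split=> [[eps eps0 h]|_ [p _ h]]; last exact: (unbounded (map_poly ratr p)).
apply: (unbounded (eps^-1)%:P) => i /=.
by rewrite hornerC invr_gt0 eps0 div1r invrK; split=> //; exact: h.
Qed.
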